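(* Let $s\ge1$ be real and $n\in\mathbb{N}$. For $0<|z|\le1$ and $x=(z+z^{-1})/2$, $$w_s(z)\mathring{T}_n^{w_s}(z)=\begin{cases}(-1)^{\frac s2}(2z)^{\frac{s+n}{2}}\,w^{(\frac s2,0)}(x)\,T_{\frac n2}^{(\frac s2,0)}(x),&n\text{ even},\\[4pt](-1)^{\frac s2}(2z)^{\frac{s+n}{2}}\,w^{(\frac s2,\frac12)}(x)\,T_{\frac{n-1}{2}}^{(\frac s2,\frac12)}(x),&n\text{ odd},\end{cases}$$ where the branches of the powers are understood so that $(-1)^{\frac s2}(2z)^{\frac s2}(1-x)^{\frac s2}=(z-1)^s=w_s(z)$ and $(2z)^{\frac12}(1+x)^{\frac12}=z+1$. As a consequence, $$\|w_s\mathring{T}_n^{w_s}\|_{\mathbb{T}}=\begin{cases}2^{\frac{s+n}{2}}\,\big\|w^{(\frac s2,0)}T_{\frac n2}^{(\frac s2,0)}\big\|_{[-1,1]},&n\text{ even},\\[4pt]2^{\frac{s+n}{2}}\,\big\|w^{(\frac s2,\frac12)}T_{\frac{n-1}{2}}^{(\frac s2,\frac12)}\big\|_{[-1,1]},&n\text{ odd}.\end{cases}$$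
   Context: $\mathbb{T}$ is the unit circle, $\mathbb{D}$ the open unit disk, $\mathbb{N}$ the positive integers, and $\|g\|_E=\sup_{z\in E}|g(z)|$. $w_s(z)=(z-1)^s$ on $\overline{\mathbb{D}}$, with a branch analytic in $\mathbb{D}$ and continuous on $\overline{\mathbb{D}}$. For $s\ge1$, $\mathring{T}_n^{w_s}$ denotes the (unique) polynomial of the form $\prod_{k=1}^n(z-e^{i\alpha_k^*})$, $\alpha_k^*\in[0,2\pi)$, attaining $\min_{\alpha_1,\dots,\alpha_n\in[0,2\pi)}\max_{z\in\mathbb{T}}\left|(z-1)^s\prod_{k=1}^n(z-e^{i\alpha_k})\right|$. For $\alpha,\beta\ge0$, $w^{(\alpha,\beta)}(x)=(1-x)^\alpha(1+x)^\beta$ (for $x\in[-1,1]$ with nonnegative real powers; for complex $x$ by the same formula with branches as specified in the claim), and for an integer $m\ge 0$, $T_m^{(\alpha,\beta)}$ is the unique monic polynomial of degree $m$ attaining $\min_{a_1,\dots,a_m\in\mathbb{C}}\max_{x\in[-1,1]}\left|w^{(\alpha,\beta)}(x)\prod_{k=1}^m(x-a_k)\right|$ (with $T_0^{(\alpha,\beta)}=1$). *)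

(* Defs.v *)
From HB Require Import structures.
From mathcomp Require Import all_boot all_order all_algebra.
From mathcomp Require Import complex.
From mathcomp Require Import all_classical all_reals all_analysis.

Set Implicit Arguments.
Unset Strict Implicit.
Unset Printing Implicit Defensive.

Import Order.TTheory GRing.Theory Num.Theory.
Import numFieldNormedType.Exports.

Local Open Scope classical_set_scope.
Local Open Scope ring_scope.
Local Open Scope complex_scope.

(* sup of |g| over E, as an element of R; [sup] returns 0 on unbounded sets, but
   it is only applied below to functions that are bounded on E. *)
Definition supnorm (R : realType) (T : Type) (E : set T) (g : T -> R[i]) : R :=
  sup [set complex.Re `|g z| | z in E].

Definition expi (R : realType) (t : R) : R[i] := cos t +i* sin t.

Definition cexp (R : realType) (z : R[i]) : R[i] :=
  (expR (complex.Re z))%:C * expi (complex.Im z).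

(* v is one of the values of the multivalued power a^p, i.e. exp (p * l) for
   some logarithm l of a; moreover 0^p = 0 for p != 0 and 0^0 = 1. *)
Definition is_cpow (R : realType) (a : R[i]) (p : R) (v : R[i]) : Prop :=
  if a == 0 then v = (p == 0)%:R
  else exists2 l : R[i], cexp l = a & v = cexp (p%:C * l).

(* Derivability along the vector 1 with scalars in R[i] is complex
   differentiability. Only the values of w on the closed disk matter. *)
Definition is_pow_branch (R : realType) (s : R) (w : R[i] -> R[i]) : Prop :=
  [/\ forall z, `|z| <= 1 -> is_cpow (z - 1) s (w z),
      forall z, `|z| < 1 -> derivable (w : R[i]^o -> R[i]^o) z 1 &
      {within [set z : R[i]^o | `|z| <= 1],
        continuous (w : R[i]^o -> R[i]^o)}].

(* The interval [-1, 1] consists of real x, and [powR] is the nonnegative real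
   power, with 0 `^ 0 = 1. *)
Definition jacobi_weight (R : realType) (a b x : R) : R :=
  (1 - x) `^ a * (1 + x) `^ b.

Definition minimizer (R : realType) (F : {poly R[i]} -> Prop)
    (N : {poly R[i]} -> R) (p : {poly R[i]}) : Prop :=
  F p /\ forall q, F q -> N p <= N q.

(* Products prod_k (z - e^{i alpha_k}) with alpha_k in [0, 2 pi). *)
Definition circle_poly (R : realType) (n : nat) (p : {poly R[i]}) : Prop :=
  exists2 alpha : 'I_n -> R, forall k, 0 <= alpha k < 2 * pi &
    p = \prod_(k < n) ('X - (expi (alpha k))%:P).

Definition unit_circle (R : realType) : set R[i] := [set z | `|z| = 1].
Arguments unit_circle R : clear implicits.

(* [unique Q p]: p satisfies Q and is equal to every polynomial satisfying Q;
   uniqueness is that of the polynomial, not of the tuple alpha. *)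
Definition is_circle_chebyshev (R : realType) (w : R[i] -> R[i]) (n : nat) :
    {poly R[i]} -> Prop :=
  unique (minimizer (circle_poly n)
    (fun p : {poly R[i]} => supnorm (unit_circle R) (fun z => w z * p.[z]))).

(* All the a_k are complex: over R[i] these are exactly the monic polynomials
   of degree m. *)
Definition split_poly (R : realType) (m : nat) (p : {poly R[i]}) : Prop :=
  exists a : 'I_m -> R[i], p = \prod_(k < m) ('X - (a k)%:P).

Definition jacobi_norm (R : realType) (a b : R) (p : {poly R[i]}) : R :=
  supnorm `[-1, 1] (fun x : R => (jacobi_weight a b x)%:C * p.[x%:C]).

Definition is_jacobi_chebyshev (R : realType) (a b : R) (m : nat) :
    {poly R[i]} -> Prop :=
  unique (minimizer (split_poly m) (jacobi_norm a b)).

(* At the point z, with x = (z + z^-1) / 2: A, B, C, D and E are values of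
   (-1)^(s/2), (2z)^(s/2), (1-x)^(s/2), (2z)^(1/2) and (1+x)^(1/2), chosen so
   that (-1)^(s/2) (2z)^(s/2) (1-x)^(s/2) = (z-1)^s = w(z) and
   (2z)^(1/2) (1+x)^(1/2) = z + 1. No choice consistent in z is imposed: 2z is
   not a single-valued base of non-integer powers on the punctured disk. *)
Definition compatible_branches (R : realType) (s : R) (w : R[i] -> R[i])
    (z A B C D E : R[i]) : Prop :=
  let x := (z + z^-1) / 2 in
  [/\ is_cpow (-1) (s / 2) A,
      is_cpow (2 * z) (s / 2) B /\ is_cpow (1 - x) (s / 2) C,
      is_cpow (2 * z) (1 / 2) D /\ is_cpow (1 + x) (1 / 2) E,
      A * B * C = w z &
      D * E = z + 1].

(* Main.v *)
(* On the circle only the modulus |w(z)| = |z - 1|^s matters.  The minimizer P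
   does not vanish at 1: otherwise rotate its other zeros by a small eps and the
   zero at 1 by (s + 1) eps; concavity of log sin shows that the norm does not
   increase, against uniqueness.  Uniqueness also makes P invariant under
   conjugation, so its zeros are conjugate pairs and, for odd n, one extra -1.
   As (z - v)(z - 1/v) = 2z (x - Re v), P is (z + 1)^(odd n) (2z)^(n./2) q(x)
   with the zeros of q in [-1, 1], and the norm of w P is a fixed multiple of the
   Jacobi-weighted norm of q.  Moving the zeros of T to the nearest points of
   [-1, 1] does not increase its norm and produces a competitor of P, so q is
   also a Jacobi minimizer, whence q = T. *)
Require Import Defs.
From HB Require Import structures.
From mathcomp Require Import all_boot all_order all_algebra.
From mathcomp Require Import complex.
From mathcomp Require Import all_classical all_reals all_analysis.
From mathcomp Require Import ring lra.

Set Implicit Arguments.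
Unset Strict Implicit.
Unset Printing Implicit Defensive.

Import Order.TTheory GRing.Theory Num.Theory.
Import numFieldNormedType.Exports.

Local Open Scope classical_set_scope.
Local Open Scope ring_scope.
Local Open Scope complex_scope.

Import ComplexField.Normc.

(** * Complex exponentials and moduli, and Jensen's inequality for log sin *)

Section ComplexExponential.
Variable R : realType.
Implicit Types (s t p : R) (z a u v l : R[i]).

Lemma normc_ge0 z : 0 <= normc z.
Proof. by case: z => a b; exact: sqrtr_ge0. Qed.

Lemma normc_eq0 z : (normc z == 0) = (z == 0).
Proof. by apply/eqP/eqP => [/eq0_normc|->]; last exact: normc0. Qed.

Lemma normr_normc z : `|z| = (normc z)%:C.
Proof. by []. Qed.

Lemma sqr_normcE z : normc z ^+ 2 = complex.Re z ^+ 2 + complex.Im z ^+ 2.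
Proof. by case: z => a b /=; rewrite sqr_sqrtr // addr_ge0 ?sqr_ge0. Qed.

Lemma normc_conjc z : normc (conjc z) = normc z.
Proof. by case: z => a b /=; rewrite sqrrN. Qed.

Lemma normc_real (x : R) : normc x%:C = `|x|.
Proof. by rewrite /= expr0n /= addr0 sqrtr_sqr. Qed.

Lemma normcX z n : normc (z ^+ n) = normc z ^+ n.
Proof.
elim: n => [|n IH]; first exact: normc1.
by rewrite !exprS normcM IH.
Qed.

Lemma normc_prod (I : Type) (r : seq I) (P : pred I) (F : I -> R[i]) :
  normc (\prod_(i <- r | P i) F i) = \prod_(i <- r | P i) normc (F i).
Proof. exact: (big_morph _ (@normcM R) (@normc1 R)). Qed.

Lemma expiD s t : expi (s + t) = expi s * expi t.
Proof. by rewrite /expi cosD sinD; simpc; congr Complex; rewrite addrC. Qed.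

Lemma normc_expi t : normc (expi t) = 1.
Proof. by rewrite /= cos2Dsin2 sqrtr1. Qed.

Lemma expi_surj u : normc u = 1 ->
  exists2 t, 0 <= t < 2 * pi & u = expi t.
Proof.
move=> u1; have := sqr_normcE u; rewrite u1 expr1n.
case: u u1 => a b /= _ ab1.
have a_itv : -1 <= a <= 1 by nra.
have cosa : cos (acos a) = a by apply: acosK; rewrite in_itv.
have sina : sin (acos a) = `|b|.
  by rewrite sin_acos // -sqrtr_sqr; congr Num.sqrt; lra.
have pi0 := @pi_gt0 R.
have [b0|b0] := leP 0 b.
  exists (acos a); first by have := acos_ge0 a_itv; have := acos_lepi a_itv; lra.
  by rewrite /expi cosa sina ger0_norm.
(* In the lower half-plane the argument is reflected, which keeps the cosine and changes the sign of
   the sine. *)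
exists (2 * pi - acos a).
  have : 0 < acos a by apply: acos_gt0; nra.
  by have := acos_lepi a_itv; lra.
rewrite mulr_natl /expi addrC cosD2pi sinD2pi cosN sinN cosa sina.
by rewrite ltr0_norm // opprK.
Qed.

Lemma cexpD z u : cexp (z + u) = cexp z * cexp u.
Proof.
by case: z u => [a b] [c d]; rewrite /cexp /= expRD rmorphM /= expiD mulrACA.
Qed.

Lemma normc_cexp z : normc (cexp z) = expR (complex.Re z).
Proof. by rewrite normcM normc_real normc_expi mulr1 gtr0_norm ?expR_gt0. Qed.

Lemma cexp_surj a : a != 0 -> exists l, cexp l = a.
Proof.
move=> a0; have na : 0 < normc a by rewrite lt_def normc_ge0 normc_eq0 a0.
have u1 : normc (a / (normc a)%:C) = 1.
  by rewrite normcM normcV normc_real gtr0_norm // divff // gt_eqF.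
have [t _ et] := expi_surj u1.
exists (ln (normc a) +i* t); rewrite /cexp /= -et lnK ?posrE // mulrC divfK //.
by rewrite -normr_normc normr_eq0.
Qed.

(** Since p is real, Re (p l) = p Re l, so the modulus does not depend on the chosen logarithm l. At
    a = 0 both sides are 0. *)
Lemma normc_is_cpow a p v : is_cpow a p v -> p != 0 -> normc v = normc a `^ p.
Proof.
rewrite /is_cpow; have [->|a0] := eqVneq a 0 => [-> p0|[l <- ->] _].
  by rewrite (negPf p0) normc0 powR0.
rewrite !normc_cexp -expRM; congr expR.
by case: l => x y /=; rewrite mul0r subr0 mulrC.
Qed.

Lemma normc_expi_subr1 t : 0 <= t <= 2 * pi -> normc (expi t - 1) = 2 * sin (t / 2).
Proof.
move=> t_itv; have s0 : 0 <= sin (t / 2) by apply: sin_ge0_pi; lra.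
apply/eqP; rewrite -(@eqrXn2 _ 2) ?normc_ge0 ?mulr_ge0 //; apply/eqP.
have et : t = (t / 2) *+ 2 by rewrite -mulr_natr divfK.
have sc := cos2Dsin2 (t / 2).
rewrite sqr_normcE /= [X in cos X]et [X in sin X]et sin_mulr2n cos_mulr2n.
move: sc; set c := cos _; set s := sin _ => sc.
have -> : (c ^+ 2 *+ 2 - 1 - 1) ^+ 2 + ((c * s) *+ 2 - 0) ^+ 2 =
          (c ^+ 2 *+ 2 - 2) ^+ 2 + 4 * c ^+ 2 * s ^+ 2 by ring.
have -> : c ^+ 2 = 1 - s ^+ 2 by lra.
ring.
Qed.

(** Concavity of sin on [0, pi]: by the mean value theorem the slope between a and c is a value of
    cos, which decreases there. *)
Lemma sin_le_tangent (a c : R) : 0 <= a <= pi -> 0 <= c <= pi ->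
  sin a <= sin c + cos c * (a - c).
Proof.
have mvt (x y : R) : x <= y ->
    exists2 k, k \in `[x, y]%R & sin y - sin x = cos k * (y - x).
  move=> xy; apply: (@MVT_segment _ sin cos) => //.
  by apply: continuous_subspaceT => k; exact: continuous_sin.
have cos_anti (x y : R) : 0 <= x -> y <= pi -> x <= y -> cos y <= cos x.
  move=> x0 ypi; rewrite le_eqVlt => /predU1P[->//|xy].
  by apply: ltW; rewrite ltr_cos // in_itv /=; lra.
move=> /andP[a0 api] /andP[c0 cpi].
have [ac|/ltW ca] := leP a c.
  have [k] := mvt _ _ ac; rewrite in_itv /= => /andP[ak kc] e.
  have := cos_anti k c (le_trans a0 ak) cpi kc; nra.
have [k] := mvt _ _ ca; rewrite in_itv /= => /andP[ck ka] e.
have := cos_anti c k c0 (le_trans ka api) ck; nra.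
Qed.

(** Weighted Jensen inequality for log sin, with weights s and 1. Tangents at c bound the weighted
    mean of the sines, and 1 + t <= exp t turns this into a bound on the product; no logarithm of a
    possibly zero sine is taken. *)
Lemma powR_sin_jensen s (a b c : R) : 0 < s -> 0 <= a <= pi -> 0 <= b <= pi ->
  s * a + b = (s + 1) * c ->
  sin a `^ s * sin b <= sin c `^ s * sin c.
Proof.
move=> s0 ha hb e; have hc : 0 <= c <= pi by nra.
have := sin_le_tangent ha hc; have := sin_le_tangent hb hc.
have := sin_ge0_pi ha; have := sin_ge0_pi hb; have := sin_ge0_pi hc.
move: (sin a) (sin b) (sin c) (cos c) => x y z k z0 y0 x0 hy hx.
(* The linear terms of the two tangent bounds cancel because s (a - c) + (b - c) = 0. *)
have mean : s * x + y <= (s + 1) * z by nra.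
have [z_gt0|z_le0] := ltP 0 z; last first.
  have -> : y = 0 by nra.
  by rewrite mulr0 mulr_ge0 ?powR_ge0.
have powx : (x / z) `^ s <= expR (s * (x / z - 1)).
  rewrite (mulrC s) expRM ge0_ler_powR ?nnegrE ?expR_ge0 ?divr_ge0 ?(ltW s0) //.
  by have := expR_ge1Dx (x / z - 1); rewrite addrC subrK.
have yexp : y / z <= expR (y / z - 1).
  by have := expR_ge1Dx (y / z - 1); rewrite addrC subrK.
have le1 : (x / z) `^ s * (y / z) <= 1.
  apply: le_trans (ler_pM (powR_ge0 _ _) (divr_ge0 y0 z0) powx yexp) _.
  rewrite -expRD expR_le1.
  have -> : s * (x / z - 1) + (y / z - 1) = (s * x + y - (s + 1) * z) / z.
    by field; rewrite gt_eqF.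
  by rewrite pmulr_lle0 ?invr_gt0 // subr_le0.
have ex : x = x / z * z by rewrite divfK // gt_eqF.
have ey : y = y / z * z by rewrite divfK // gt_eqF.
rewrite ex powRM ?divr_ge0 // ey mulrACA ler_piMl //.
by rewrite mulr_ge0 ?powR_ge0.
Qed.

End ComplexExponential.

(** * Supremum norms and their comparison across two sets *)

Section Supnorm.
Variables (R : realType) (T : Type) (E : set T).
Implicit Types (g : T -> R[i]) (M : R).

(** The bound M makes the supremum genuine: [sup] is 0 on an unbounded set. *)
Lemma supnorm_ub g M x : (forall y, E y -> normc (g y) <= M) -> E x ->
  normc (g x) <= supnorm E g.
Proof.
move=> gM Ex; apply: ub_le_sup; last by exists x.
by exists M => _ [y Ey <-]; exact: gM.
Qed.

Lemma supnorm_le g M : E !=set0 -> (forall y, E y -> normc (g y) <= M) ->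
  supnorm E g <= M.
Proof.
move=> [x Ex] gM; apply: ge_sup; first by exists (normc (g x)), x.
by move=> _ [y Ey <-]; exact: gM.
Qed.

End Supnorm.

(** Points are matched in both directions without asking for a bijection, as z and its conjugate on
    the circle have the same real part in [-1, 1]. *)
Lemma supnorm_scale (R : realType) (T U : Type) (E : set T) (F : set U)
    (g : T -> R[i]) (h : U -> R[i]) (c M : R) :
  0 < c -> E !=set0 -> (forall y, F y -> normc (h y) <= M) ->
  (forall x, E x -> exists2 y, F y & normc (g x) = c * normc (h y)) ->
  (forall y, F y -> exists2 x, E x & normc (g x) = c * normc (h y)) ->
  supnorm E g = c * supnorm F h.
Proof.
move=> c0 E0 hM gh hg.
have gM x : E x -> normc (g x) <= c * supnorm F h.
  by move=> /gh[y Fy ->]; rewrite ler_pM2l //; exact: supnorm_ub hM Fy.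
apply/le_anti/andP; split; first exact: supnorm_le.
rewrite -ler_pdivlMl //; apply: supnorm_le.
  by have [x /gh[y Fy _]] := E0; exists y.
move=> y /hg[x Ex gx]; rewrite ler_pdivlMl // -gx.
exact: supnorm_ub gM Ex.
Qed.

(** * Polynomials given by lists of zeros *)

Section ProductsOfLinearFactors.
Variable R : realType.
Implicit Types (z u : R[i]) (us : seq R[i]) (p : {poly R[i]}).

Lemma unit_circleE z : unit_circle R z <-> normc z = 1.
Proof. by split => [/complexI|]; rewrite /unit_circle /= ?normr_normc => ->. Qed.

(** Replaces angles by a list of unimodular zeros, to be compared up to permutation; each such zero
    has an argument in [0, 2 pi). *)
Lemma circle_polyP n p : circle_poly n p <->
  exists us, [/\ size us = n, forall u, u \in us -> normc u = 1 &
    p = \prod_(u <- us) ('X - u%:P)].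
Proof.
split=> [[alpha _ ->]|[us [<- us1 ->]]].
  exists [seq expi (alpha k) | k <- enum 'I_n]; split.
  - by rewrite size_map size_enum_ord.
  - by move=> _ /mapP[k _ ->]; exact: normc_expi.
  - by rewrite big_map big_enum.
have /choice[alpha alphaP] : forall k : 'I_(size us), exists t,
    (0 <= t < 2 * pi) /\ us`_k = expi t.
  move=> k; have [t t_itv ut] := expi_surj (us1 _ (mem_nth 0 (ltn_ord k))).
  by exists t.
exists alpha => [k|]; first by have [] := alphaP k.
rewrite (big_nth 0) big_mkord; apply: eq_bigr => k _.
by have [_ ->] := alphaP k.
Qed.

Lemma split_polyP n p : split_poly n p <->
  exists2 us : seq R[i], size us = n & p = \prod_(u <- us) ('X - u%:P).
Proof.
split=> [[a ->]|[us <- ->]].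
  exists [seq a k | k <- enum 'I_n]; first by rewrite size_map size_enum_ord.
  by rewrite big_map big_enum.
by exists (fun k => us`_k); rewrite (big_nth 0) big_mkord.
Qed.

Lemma normc_horner_prod_XsubC us z :
  normc (\prod_(u <- us) ('X - u%:P)).[z] = \prod_(u <- us) normc (z - u).
Proof.
rewrite horner_prod normc_prod; apply: eq_bigr => u _.
by rewrite hornerXsubC.
Qed.

Lemma prod_normc_subr_le us z : normc z <= 1 ->
  \prod_(u <- us) normc (z - u) <= \prod_(u <- us) (1 + normc u).
Proof.
move=> z1; apply: ler_prod => u _; rewrite normc_ge0 /=.
apply: le_trans (le_normcD _ _) _.
by rewrite (normcN u) lerD2r.
Qed.

Lemma prod_normc_circle_le us z : normc z = 1 ->
  (forall u, u \in us -> normc u = 1) ->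
  \prod_(u <- us) normc (z - u) <= 2 ^+ size us.
Proof.
move=> z1 us1; rewrite (le_trans (prod_normc_subr_le _ _)) ?z1 //.
rewrite big_seq (eq_bigr (fun=> 2)); last by move=> u /us1 ->.
by rewrite -big_seq big_const_seq count_predT iter_mulr_1.
Qed.

(** The angles c / (j + 1) lie in (0, pi], where cos is injective, so they give distinct points;
    [size p] of them are too many to be roots of p. *)
Lemma exists_expi_nonroot p (c : R) : p != 0 -> 0 < c <= pi ->
  exists2 t : R, 0 < t <= c & p.[expi t] != 0.
Proof.
move=> p0 c_itv; apply: contrapT => noroot.
pose t (j : nat) : R := c / j.+1%:R.
have t_itv j : 0 < t j <= c.
  rewrite /t divr_gt0 ?ltr0n //=; last by lra.
  by rewrite ler_pdivrMr ?ltr0n // ler_peMr ?ler1n //; lra.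
have t_inj : injective (fun j => expi (t j)).
  have t_itv0 k : t k \in `[0, pi] by have := t_itv k; rewrite in_itv /=; lra.
  move=> i j [/cos_inj tij _].
  have /mulfI/(_ _ _ (tij (t_itv0 i) (t_itv0 j))) : c != 0 by rewrite gt_eqF; lra.
  by move=> /invr_inj/eqP; rewrite eqr_nat => /eqP[].
have := max_poly_roots (rs := [seq expi (t j) | j <- iota 0 (size p)]) p0.
rewrite size_map size_iota ltnn map_inj_uniq // iota_uniq => /(_ _ isT) absurd.
suff: false by []; apply: absurd; apply/allP => _ /mapP[j _ ->]; rewrite /root.
by apply: contrapT => /negP nr; apply: noroot; exists (t j).
Qed.

End ProductsOfLinearFactors.

(** * Moving a zero away from 1 on the circle *)

Section Rotation.
Variable R : realType.
Implicit Types (z u : R[i]) (us : seq R[i]).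

(* Shifting by eps, the weight and the zero leaving 1 sit at -eps and s * eps,
   with s-weighted mean 0, so Jensen's inequality for log sin bounds
   their product by the factor |z - 1|^(s+1) of the original polynomial. *)
Lemma rotate_zeros_le (s d M : R) us : 0 < s -> 0 < d <= 1 ->
  (forall u, u \in us -> normc u = 1) ->
  d * 2 ^+ size us <= M ->
  (forall z, normc z = 1 ->
    normc (z - 1) `^ s * (normc (z - 1) * \prod_(u <- us) normc (z - u)) <= M) ->
  forall z, normc z = 1 ->
  normc (z - 1) `^ s *
    (normc (z - expi d) *
     \prod_(u <- us) normc (z - u * expi (d / (s + 1)))) <= M.
Proof.
move=> s0 d01 us1 dM hM z z1; set e := d / (s + 1).
have de : d = (s + 1) * e by rewrite /e mulrC divfK // gt_eqF; lra.
have e0 : 0 < e by rewrite divr_gt0; lra.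
have pi2 := @pi_ge2 R.
have [t t_itv ->] := expi_surj z1.
have diffE a b : normc (expi a - expi b : R[i]) = normc (expi (a - b) - 1 : R[i]).
  have -> : expi a - expi b = (expi (a - b) - 1) * expi b.
    by rewrite mulrBl mul1r -expiD subrK.
  by rewrite normcM normc_expi mulr1.
have prod_ge0 (I : Type) (r : seq I) (F : I -> R[i]) :
    0 <= \prod_(i <- r) normc (F i).
  by apply: prodr_ge0 => i _; exact: normc_ge0.
(* Outside the short arc between 1 and e^(i d), the value at angle t is compared with that of the
   original polynomial at angle t - e, where the factors of [us] agree and Jensen's inequality
   handles the rest. *)
have [dt|td] := leP d t.
  apply: le_trans (hM (expi (t - e)) (normc_expi _)).
  have -> : \prod_(u <- us) normc (expi t - u * expi e) =
            \prod_(u <- us) normc (expi (t - e) - u).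
    apply: eq_bigr => u _.
    by rewrite -{1}(subrK e t) expiD -mulrBl normcM normc_expi mulr1.
  rewrite !mulrA ler_wpM2r //.
  rewrite diffE !normc_expi_subr1; [|nra..].
  have := @powR_sin_jensen R s (t / 2) ((t - d) / 2) ((t - e) / 2) s0.
  have ? : 0 <= t / 2 <= pi by lra.
  have ? : 0 <= (t - d) / 2 <= pi by lra.
  have ? : 0 <= sin ((t - e) / 2) by apply: sin_ge0_pi; nra.
  have ? : 0 <= sin (t / 2) by apply: sin_ge0_pi; lra.
  move=> /(_ _ _ _)-jensen; rewrite !powRM //.
  rewrite -!mulrA ler_pM2l ?powR_gt0 // ![_ * (2 * _)]mulrCA ler_pM2l //.
  by apply: jensen => //; rewrite de; field.
(* On the short arc 0 <= t < d a crude bound suffices: the weight is at most 1, the moved factor at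
   most d, and each remaining factor at most 2. *)
have chord a : 0 <= a <= 1 -> normc (expi a - 1 : R[i]) <= a.
  move=> a_itv; rewrite normc_expi_subr1; last by lra.
  have := @sin_le_tangent R (a / 2) 0; rewrite sin0 cos0; lra.
apply: le_trans dM; rewrite -[leRHS]mul1r.
apply: ler_pM; rewrite ?powR_ge0 ?mulr_ge0 ?normc_ge0 //.
  have <- : 1 `^ s = 1 :> R by rewrite powR1.
  rewrite ge0_ler_powR ?nnegrE ?normc_ge0 ?(ltW s0) //.
  by rewrite (le_trans (chord _ _)); lra.
apply: ler_pM; rewrite ?normc_ge0 //.
  rewrite -normcN opprB diffE (le_trans (chord _ _)); lra.
have -> : \prod_(u <- us) normc (expi t - u * expi e) =
          \prod_(u <- [seq u * expi e | u <- us]) normc (expi t - u).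
  by rewrite big_map.
rewrite (le_trans (prod_normc_circle_le (normc_expi t) _)) ?size_map //.
by move=> _ /mapP[u /us1 u1 ->]; rewrite normcM u1 normc_expi mulr1.
Qed.

End Rotation.

(** * Conjugate pairs of zeros and the substitution x = (z + 1/z) / 2 *)

Section ReciprocalPairs.
Variable R : realType.
Implicit Types (z u : R[i]) (us vs : seq R[i]).

(** In use, b is the parity of the degree; a double zero at -1 is recorded as an element -1 of
    [vs]. *)
Definition conj_pairs (b : nat) vs := nseq b (-1) ++ vs ++ map conjc vs.

Lemma size_conj_pairs b vs : size (conj_pairs b vs) = (b + (size vs).*2)%N.
Proof. by rewrite !size_cat size_nseq size_map addnn. Qed.

Lemma conj_pairs_norm1 b vs : (forall v, v \in vs -> normc v = 1) ->
  forall u, u \in conj_pairs b vs -> normc u = 1.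
Proof.
move=> vs1 u; rewrite !mem_cat => /or3P[/nseqP[-> _]|/vs1//|/mapP[v /vs1 v1 ->]].
  by rewrite normcN normc1.
by rewrite normc_conjc.
Qed.

(** Induction on the size, removing a non-real zero together with its conjugate. Once all zeros are
    real, being unimodular and different from 1, they all equal -1. *)
Lemma perm_conj_pairs us : (forall u, u \in us -> normc u = 1) ->
  1 \notin us -> perm_eq us (map conjc us) ->
  exists vs, perm_eq us (conj_pairs (odd (size us)) vs).
Proof.
have [k] := ubnP (size us); elim: k us => // k IH us us_k us1 us_n1 usJ.
have [/hasP[u u_us uJ]|/hasPn all_real] := boolP (has (fun u => conjc u != u) us).
  have Ju_us : conjc u \in us.
    by rewrite (perm_mem usJ) mem_map //; exact: (can_inj (@conjcK R)).
  have us_u := perm_to_rem u_us.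
  have : conjc u \in rem u us.
    by move: Ju_us; rewrite (perm_mem us_u) inE (negPf uJ).
  set us' := rem u us in us_u * => /perm_to_rem; set us2 := rem _ us' => us'_Ju.
  have {us_u us'_Ju} us_us2 : perm_eq us (u :: conjc u :: us2).
    by rewrite (perm_trans us_u) // perm_cons.
  have us2J : perm_eq us2 (map conjc us2).
    rewrite -(perm_cons (conjc u)) -(perm_cons u) perm_sym.
    rewrite perm_sym -(permPl us_us2) (permPl usJ).
    rewrite (permPl (perm_map _ us_us2)) /= conjcK.
    by rewrite -(cat1s u) -(cat1s (conjc u)) perm_catCA.
  have size_us : size us = (size us2).+2 by rewrite (perm_size us_us2).
  have us2_us v : v \in us2 -> v \in us.
    by rewrite (perm_mem us_us2) !inE => ->; rewrite !orbT.
  have [|v /us2_us/us1//||//|vs us2_vs] := IH us2.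
  - by apply: ltnW; rewrite -ltnS -size_us.
  - by apply: contra us_n1 => /us2_us.
  exists (u :: vs); apply/permP => p; rewrite (permP us_us2) size_us /= negbK.
  by rewrite (permP us2_vs) /conj_pairs !count_cat /=; ring.
have usN1 : us = nseq (size us) (-1).
  apply/all_pred1P/allP => u u_us /=.
  have := sqr_normcE u; rewrite us1 // expr1n.
  have : u != 1 by apply: contraNneq us_n1 => <-.
  have := all_real u u_us; rewrite negbK.
  case: u {u_us} => a b; rewrite !eq_complex /= oppr0 eqxx andTb.
  move=> /eqP bN; have -> : b = 0 by lra.
  rewrite eqxx !andbT expr0n addr0 => a1 /esym/eqP.
  by rewrite sqrf_eq1 (negPf a1).
(* As -1 is its own conjugate, half of the zeros, rounded down, serve as [vs]; the parity accounts
   for one possible leftover. *)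
exists (nseq (size us)./2 (-1)); rewrite /conj_pairs map_nseq /= oppr0.
by rewrite -!nseqD addnn odd_double_half -usN1.
Qed.

(** An algebraic identity for every nonzero z, on the circle or not, as the formula in the punctured
    disk requires. It rests on v times its conjugate being 1. *)
Lemma prod_conj_pairs b vs z : (forall v, v \in vs -> normc v = 1) -> z != 0 ->
  (\prod_(u <- conj_pairs b vs) ('X - u%:P)).[z] =
  (z + 1) ^+ b * (2 * z) ^+ size vs *
  (\prod_(v <- vs) ('X - ((complex.Re v)%:C)%:P)).[(z + z^-1) / 2].
Proof.
move=> vs1 z0; rewrite big_cat big_cat /= big_map !hornerM -!mulrA; congr (_ * _).
  rewrite big_nseq iter_mulr_1 horner_exp hornerXsubC opprK //.
rewrite -hornerM -big_split /= !horner_prod.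
elim: vs vs1 => [|v vs IH] vs1; first by rewrite !big_nil mulr1.
rewrite !big_cons IH => [|u u_vs]; last by apply: vs1; rewrite inE u_vs orbT.
have v1 := vs1 v (mem_head _ _).
rewrite exprS mulrACA; congr (_ * _).
rewrite hornerM !hornerXsubC.
have vJ : v * conjc v = 1.
  have := sqr_normcE v; rewrite v1 expr1n; case: v {v1 vs1} => x y /= e.
  by apply/eqP; rewrite eq_complex /=; apply/andP; split; apply/eqP; lra.
transitivity (z * z - (v + conjc v) * z + v * conjc v); first by ring.
by rewrite addcJ vJ; field.
Qed.

End ReciprocalPairs.

(** * Zeros of the minimizer on the circle *)

Section CircleChebyshev.
Variables (R : realType) (s : R) (w : R[i] -> R[i]).
Hypothesis s_gt0 : 0 < s.
Hypothesis normc_w : forall z, normc z <= 1 -> normc (w z) = normc (z - 1) `^ s.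
Implicit Types (z u v : R[i]) (us vs : seq R[i]) (p q P T : {poly R[i]}).

Local Notation circle_norm p :=
  (supnorm (unit_circle R) (fun z : R[i] => w z * p.[z])).

Lemma circle_nonempty : unit_circle R !=set0.
Proof. by exists 1; apply/unit_circleE; exact: normc1. Qed.

Lemma normc_w_circle us z : normc z = 1 ->
  normc (w z * (\prod_(u <- us) ('X - u%:P)).[z]) =
  normc (z - 1) `^ s * \prod_(u <- us) normc (z - u).
Proof. by move=> z1; rewrite normcM normc_w ?z1 // normc_horner_prod_XsubC. Qed.

Lemma circle_poly_bounded n p : circle_poly n p ->
  exists M, forall z, unit_circle R z -> normc (w z * p.[z]) <= M.
Proof.
move=> /circle_polyP[us [_ us1 ->]]; exists (2 `^ s * 2 ^+ size us) => z.
move=> /unit_circleE z1; rewrite normc_w_circle //.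
have prod_ge0 : 0 <= \prod_(u <- us) normc (z - u).
  by apply: prodr_ge0 => u _; exact: normc_ge0.
rewrite ler_pM ?powR_ge0 //; last exact: prod_normc_circle_le.
rewrite ge0_ler_powR ?nnegrE ?normc_ge0 ?(ltW s_gt0) //.
by rewrite (le_trans (le_normcD _ _)) // (normcN 1) z1 normc1.
Qed.

Lemma circle_poly_ub n p z : circle_poly n p -> normc z = 1 ->
  normc (w z * p.[z]) <= circle_norm p.
Proof.
move=> /circle_poly_bounded[M pM] /unit_circleE.
exact: (@supnorm_ub _ _ _ (fun z => w z * p.[z]) M).
Qed.

(** If 1 were a zero, rotating the zeros would yield another minimizer, with a zero that P does not
    have. *)
Lemma circle_chebyshev_horner1 n P : is_circle_chebyshev w n P -> P.[1] != 0.
Proof.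
move=> [[Pn Pmin] Puniq]; apply/negP => P1.
have [us [us_n us1 eP]] := (circle_polyP n P).1 Pn.
have us_1 : 1 \in us by rewrite -root_prod_XsubC -eP.
have us_perm := perm_to_rem us_1; set us' := rem 1 us in us_perm.
have us'1 u : u \in us' -> normc u = 1 by move=> /mem_rem/us1.
have P0 : P != 0 by rewrite eP monic_neq0 ?monic_prod_XsubC.
have pi2 := @pi_ge2 R.
set M := circle_norm P.
(* A positive norm leaves room for a positive d with d 2^k <= M, where k is the number of other
   zeros. *)
have M_gt0 : 0 < M.
  have [t t_itv Pt] : exists2 t : R, 0 < t <= 1 & P.[expi t] != 0.
    by apply: exists_expi_nonroot => //; lra.
  apply: lt_le_trans (circle_poly_ub Pn (normc_expi t)).
  rewrite normcM normc_w ?normc_expi // mulr_gt0 //.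
    rewrite powR_gt0 // normc_expi_subr1 ?mulr_gt0 ?sin_gt0_pi //; lra.
  by rewrite lt_def normc_ge0 normc_eq0 Pt.
pose c := Num.min 1 (M / 2 ^+ size us').
have c_gt0 : 0 < c by rewrite lt_min ltr01 divr_gt0 ?exprn_gt0.
have c_le1 : c <= 1 by rewrite ge_min lexx.
(* The new zero e^(i d) is chosen off the zeros of P, so that the competitor differs from P. *)
have [d d_itv Pd] : exists2 d : R, 0 < d <= c & P.[expi d] != 0.
  by apply: exists_expi_nonroot => //; lra.
have d01 : 0 < d <= 1 by lra.
have dM : d * 2 ^+ size us' <= M.
  rewrite -ler_pdivlMr ?exprn_gt0 //.
  have /andP[_ dc] := d_itv; apply: le_trans dc _.
  by rewrite ge_min lexx orbT.
pose vs := expi d :: [seq u * expi (d / (s + 1)) | u <- us'].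
have Qn : circle_poly n (\prod_(v <- vs) ('X - v%:P)).
  apply/circle_polyP; exists vs; split=> //.
    by rewrite /= size_map -us_n (perm_size us_perm).
  move=> v; rewrite inE => /orP[/eqP->|/mapP[u /us'1 u1 ->]].
    exact: normc_expi.
  by rewrite normcM u1 normc_expi mulr1.
have QM : circle_norm (\prod_(v <- vs) ('X - v%:P)) <= M.
  apply: supnorm_le circle_nonempty _ => z /unit_circleE z1.
  rewrite normc_w_circle // big_cons big_map.
  apply: rotate_zeros_le => // {}z {}z1.
  have := circle_poly_ub Pn z1; rewrite -/M eP normc_w_circle //.
  by rewrite (perm_big _ us_perm) big_cons.
have /Puniq PQ : minimizer (circle_poly n) (fun p => circle_norm p)
    (\prod_(v <- vs) ('X - v%:P)).
  by split=> // q /Pmin; exact: le_trans.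
move: Pd; rewrite PQ -[_ == 0]/(root _ _) root_prod_XsubC mem_head //.
Qed.

(** Conjugating the zeros keeps the norm, since the modulus of the weight is the same at z and at
    its conjugate; uniqueness concludes. *)
Lemma circle_chebyshev_conj n P : is_circle_chebyshev w n P -> map_poly conjc P = P.
Proof.
move=> [[Pn Pmin] Puniq].
have [us [us_n us1 eP]] := (circle_polyP n P).1 Pn.
have QE z : (map_poly conjc P).[z] = conjc (P.[conjc z]).
  by rewrite -{1}(conjcK z) horner_map.
have Qn : circle_poly n (map_poly conjc P).
  apply/circle_polyP; exists (map conjc us); split.
  - by rewrite size_map.
  - by move=> _ /mapP[u /us1 u1 ->]; rewrite normc_conjc.
  - by rewrite eP map_prod_XsubC big_map.
apply/esym/Puniq; split=> // q /Pmin; apply: le_trans.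
apply: supnorm_le circle_nonempty _ => z /unit_circleE z1.
apply: le_trans (circle_poly_ub Pn (z := conjc z) _); last by rewrite normc_conjc.
rewrite QE !normcM normc_conjc !normc_w ?normc_conjc ?z1 //.
by rewrite -(normc_conjc (conjc z - 1)) rmorphB rmorph1 /= conjcK.
Qed.

Lemma circle_chebyshev_conj_pairs n P : is_circle_chebyshev w n P ->
  exists vs, [/\ n = (odd n + (size vs).*2)%N,
    forall v, v \in vs -> normc v = 1 &
    P = \prod_(u <- conj_pairs (odd n) vs) ('X - u%:P)].
Proof.
move=> Pch; have [us [us_n us1 eP]] := (circle_polyP n P).1 Pch.1.1.
have us_n1 : 1 \notin us.
  by rewrite -root_prod_XsubC -eP; exact: circle_chebyshev_horner1 Pch.
have usJ : perm_eq us (map conjc us).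
  apply: prod_XsubC_eq; rewrite -eP -(circle_chebyshev_conj Pch) eP.
  by rewrite map_prod_XsubC big_map.
have [vs us_vs] := perm_conj_pairs us1 us_n1 usJ.
rewrite us_n in us_vs; exists vs; split.
- by rewrite -size_conj_pairs -(perm_size us_vs).
- move=> v v_vs; apply: us1; rewrite (perm_mem us_vs) !mem_cat v_vs.
  by rewrite orbT.
- by rewrite eP; exact: perm_big.
Qed.

End CircleChebyshev.

(** * Jacobi-weighted norms and projection of zeros onto [-1, 1] *)

Section JacobiNorm.
Variables (R : realType).
Implicit Types (a b : R) (x : R) (m : nat) (q T : {poly R[i]}) (us : seq R[i]).

Lemma jacobi_weight_ge0 a b x : 0 <= jacobi_weight a b x.
Proof. by rewrite mulr_ge0 ?powR_ge0. Qed.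

Lemma normc_jacobi a b us x :
  normc ((jacobi_weight a b x)%:C * (\prod_(u <- us) ('X - u%:P)).[x%:C]) =
  jacobi_weight a b x * \prod_(u <- us) normc (x%:C - u).
Proof.
by rewrite normcM normc_real ger0_norm ?jacobi_weight_ge0 // normc_horner_prod_XsubC.
Qed.

Lemma jacobi_bounded a b m q : 0 <= a -> 0 <= b -> split_poly m q ->
  exists M, forall x, `[-1, 1]%classic x ->
    normc ((jacobi_weight a b x)%:C * q.[x%:C]) <= M.
Proof.
move=> a0 b0 /split_polyP[us _ ->].
exists (2 `^ a * 2 `^ b * \prod_(u <- us) (1 + normc u)) => x.
rewrite /= in_itv /= => /andP[x_ge x_le]; rewrite normc_jacobi.
have x1 : normc (x%:C : R[i]) <= 1 by rewrite normc_real ler_norml x_ge x_le.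
rewrite ler_pM ?jacobi_weight_ge0 ?prod_normc_subr_le //; last first.
  by rewrite ler_pM ?powR_ge0 // ge0_ler_powR ?nnegrE //; lra.
by apply: prodr_ge0 => u _; exact: normc_ge0.
Qed.

(** The point of [-1, 1] nearest to u in the complex plane. *)
Definition clamp1 (u : R[i]) : R := Num.max (-1) (Num.min 1 (complex.Re u)).

Lemma clamp1_itv u : -1 <= clamp1 u <= 1.
Proof. by rewrite /clamp1 le_max lexx ge_max ge_min lexx /=; lra. Qed.

(** Dropping the imaginary part, then clamping the real part, each bring u no farther from a point
    of [-1, 1]. *)
Lemma normc_subr_clamp1_le x u : -1 <= x <= 1 ->
  normc (x%:C - (clamp1 u)%:C) <= normc (x%:C - u).
Proof.
move=> x_itv; rewrite -rmorphB normc_real.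
have le_re : `|x - complex.Re u| <= normc (x%:C - u).
  by case: u => a b /=; rewrite -sqrtr_sqr ler_wsqrtr // lerDl sqr_ge0.
apply: le_trans le_re; rewrite /clamp1.
have [u1|u1] := leP 1 (complex.Re u).
  by rewrite max_r ?ler_norml; [rewrite !ler0_norm|]; lra.
by have [u2|u2] := leP (complex.Re u) (-1); rewrite // !ger0_norm; lra.
Qed.

End JacobiNorm.

(** * Passage from the circle to the interval *)

Section Transfer.
Variables (R : realType) (s : R) (w : R[i] -> R[i]).
Hypothesis s_gt0 : 0 < s.
Hypothesis normc_w : forall z, normc z <= 1 -> normc (w z) = normc (z - 1) `^ s.
Implicit Types (z u v : R[i]) (us vs : seq R[i]) (p q P T : {poly R[i]}).

Local Notation circle_norm p :=
  (supnorm (unit_circle R) (fun z : R[i] => w z * p.[z])).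

Lemma normc_conj_pairs (b : nat) vs z :
  (forall v, v \in vs -> normc v = 1) -> normc z = 1 ->
  normc (w z * (\prod_(u <- conj_pairs b vs) ('X - u%:P)).[z]) =
  2 `^ ((s + (b + (size vs).*2)%:R) / 2) *
  normc ((jacobi_weight (s / 2) (b%:R / 2) (complex.Re z))%:C *
         (\prod_(v <- vs) ('X - ((complex.Re v)%:C)%:P)).[(complex.Re z)%:C]).
Proof.
move=> vs1 z1; set x := complex.Re z.
have ab1 : x ^+ 2 + complex.Im z ^+ 2 = 1 by rewrite -sqr_normcE z1 expr1n.
have x_itv : -1 <= x <= 1 by nra.
have z0 : z != 0 by rewrite -normc_eq0 z1 oner_eq0.
have zx : (z + z^-1) / 2 = x%:C.
  have -> : z^-1 = conjc z.
    apply: (mulfI z0); rewrite divff //; apply/esym/eqP.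
    case: z @x ab1 {x_itv z0 z1} => a c /= ab1.
    by rewrite eq_complex /=; apply/andP; split; apply/eqP; lra.
  by rewrite addcJ mulrC mulKf.
rewrite prod_conj_pairs // zx !normcM !normcX normc_w ?z1 //.
have -> : normc (2 * z) = 2.
  by rewrite normcM z1 mulr1 -(rmorph_nat (real_complex R)) normc_real normr_nat.
rewrite normc_real ger0_norm ?jacobi_weight_ge0 // /jacobi_weight !mulrA; congr (_ * _).
(* Applied with y = |z - 1| and y = |z + 1|, whose squares are 2 (1 - x) and 2 (1 + x); this halves
   the exponents of the weight. *)
have powE (y t e : R) : 0 <= y -> 0 <= t -> y ^+ 2 = 2 * t ->
    y `^ e = 2 `^ (e / 2) * t `^ (e / 2).
  move=> y0 t0 yt; rewrite -powRM // -yt -powR_mulrn // -powRrM.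
  by rewrite mulrC divfK.
rewrite -(powR_mulrn b) ?normc_ge0 //.
have zB1 : normc (z - 1) ^+ 2 = 2 * (1 - x).
  have [reE imE] : complex.Re (z - 1) = x - 1 /\ complex.Im (z - 1) = complex.Im z.
    by rewrite /x; case: (z) => a c /=; rewrite oppr0 addr0.
  by rewrite sqr_normcE reE imE; lra.
have zD1 : normc (z + 1) ^+ 2 = 2 * (1 + x).
  have [reE imE] : complex.Re (z + 1) = x + 1 /\ complex.Im (z + 1) = complex.Im z.
    by rewrite /x; case: (z) => a c /=; rewrite addr0.
  by rewrite sqr_normcE reE imE; lra.
rewrite (powE _ _ _ (normc_ge0 _) _ zB1) ?(powE _ _ _ (normc_ge0 _) _ zD1); [|lra..].
rewrite -powR_mulrn //.
(* The three powers of 2 come from |z - 1|^s, |z + 1|^b and |2z|^(size vs). *)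
have -> : 2 `^ ((s + (b + (size vs).*2)%:R) / 2) =
          2 `^ (s / 2) * 2 `^ (b%:R / 2) * 2 `^ (size vs)%:R :> R.
  rewrite -!powRD ?pnatr_eq0 ?implybT //; congr (_ `^ _).
  by rewrite natrD -muln2 natrM; field.
ring.
Qed.

(** The real part maps the circle onto [-1, 1], with right inverse x -> [expi (acos x)], so the
    pointwise identity passes to suprema. *)
Lemma supnorm_conj_pairs (b : nat) vs : (forall v, v \in vs -> normc v = 1) ->
  circle_norm (\prod_(u <- conj_pairs b vs) ('X - u%:P)) =
  2 `^ ((s + (b + (size vs).*2)%:R) / 2) *
  jacobi_norm (s / 2) (b%:R / 2) (\prod_(v <- vs) ('X - ((complex.Re v)%:C)%:P)).
Proof.
move=> vs1; set Q := \prod_(u <- _) _; set q := \prod_(v <- vs) _.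
have qn : split_poly (size vs) q.
  apply/split_polyP; exists [seq (complex.Re v)%:C | v <- vs].
    by rewrite size_map.
  by rewrite big_map.
have [||M qM] := @jacobi_bounded R (s / 2) (b%:R / 2) _ _ _ _ qn.
- by rewrite divr_ge0 // ltW.
- by rewrite divr_ge0.
apply: supnorm_scale qM _ _; first by rewrite powR_gt0.
- exact: circle_nonempty.
- move=> z /unit_circleE z1; exists (complex.Re z).
    have := sqr_normcE z; rewrite z1 expr1n /= in_itv /=; nra.
  exact: normc_conj_pairs.
- move=> x; rewrite /= in_itv /= => x_itv.
  exists (expi (acos x)); first exact/unit_circleE/normc_expi.
  have := normc_conj_pairs b vs1 (normc_expi (acos x)).
  by rewrite [complex.Re _]acosK ?in_itv.
Qed.

(** Treats both parities at once: [odd n], read as a number, is the exponent of z + 1, and half of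
    it that of 1 + x. *)
Lemma circle_chebyshev_jacobi n P T :
  is_circle_chebyshev w n P ->
  is_jacobi_chebyshev (s / 2) ((odd n)%:R / 2) n./2 T ->
  (forall z, z != 0 ->
     P.[z] = (z + 1) ^+ odd n * (2 * z) ^+ n./2 * T.[(z + z^-1) / 2]) /\
  circle_norm P = 2 `^ ((s + n%:R) / 2) * jacobi_norm (s / 2) ((odd n)%:R / 2) T.
Proof.
move=> Pch [[Tm Tmin] Tuniq].
have [vs [n_vs vs1 eP]] := circle_chebyshev_conj_pairs s_gt0 normc_w Pch.
have half_n m : n = (odd n + m.*2)%N -> m = n./2.
  by move=> ->; rewrite half_bit_double.
set q := \prod_(v <- vs) ('X - ((complex.Re v)%:C)%:P).
have qm : split_poly n./2 q.
  apply/split_polyP; exists [seq (complex.Re v)%:C | v <- vs].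
    by rewrite size_map; exact: half_n.
  by rewrite big_map.
have Pnorm := supnorm_conj_pairs (odd n) vs1; rewrite -eP -n_vs -/q in Pnorm.
have [us us_m eT] := (split_polyP n./2 T).1 Tm.
(* The clamped zeros of T are lifted to points of the circle having them as real parts. *)
pose vs' := [seq expi (acos (clamp1 u)) | u <- us].
have vs'1 v : v \in vs' -> normc v = 1 by move=> /mapP[u _ ->]; exact: normc_expi.
have n_vs' : n = (odd n + (size vs').*2)%N by rewrite size_map us_m odd_double_half.
have := supnorm_conj_pairs (odd n) vs'1; rewrite -n_vs'.
set Q := \prod_(u <- _) _; set q' := \prod_(v <- vs') _ => Qnorm.
have q'T : jacobi_norm (s / 2) ((odd n)%:R / 2) q' <=
    jacobi_norm (s / 2) ((odd n)%:R / 2) T.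
  have [||M TM] := @jacobi_bounded R (s / 2) ((odd n)%:R / 2) _ _ _ _ Tm.
  - by rewrite divr_ge0 // ltW.
  - by rewrite divr_ge0.
  apply: supnorm_le; first by exists 0; rewrite /= in_itv /=; lra.
  move=> x x_itv; apply: le_trans (supnorm_ub TM x_itv).
  rewrite /q' big_map eT !normcM ler_wpM2l ?normc_ge0 //.
  rewrite !horner_prod !normc_prod; apply: ler_prod => u _.
  rewrite normc_ge0 !hornerXsubC /= acosK ?in_itv ?clamp1_itv //.
  by apply: normc_subr_clamp1_le; move: x_itv; rewrite /= in_itv.
(* Minimality of P against the competitor [Q]: both circle norms carry the same positive factor. *)
have Pq' : jacobi_norm (s / 2) ((odd n)%:R / 2) q <=
    jacobi_norm (s / 2) ((odd n)%:R / 2) q'.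
  rewrite -(ler_pM2l (x := 2 `^ ((s + n%:R) / 2))) ?powR_gt0 // -Pnorm -Qnorm.
  apply: Pch.1.2; apply/circle_polyP; exists (conj_pairs (odd n) vs'); split=> //.
    by rewrite size_conj_pairs -n_vs'.
  exact: conj_pairs_norm1.
(* The norms satisfy q <= q' <= T, so q is a minimizer as well and uniqueness of T applies. *)
have Tq : T = q.
  apply: Tuniq; split=> // r /Tmin; apply: le_trans; exact: le_trans q'T.
split; last by rewrite Tq.
by move=> z z0; rewrite eP Tq prod_conj_pairs // (half_n _ n_vs).
Qed.

End Transfer.

(** * Values of complex powers and compatible branches *)

Section Branches.
Variable R : realType.
Implicit Types (p : R) (a b c u v z : R[i]).

Lemma is_cpow_exists a p : exists v, is_cpow a p v.
Proof.
rewrite /is_cpow; have [_|/cexp_surj[l la]] := eqVneq a 0; first by eexists.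
by exists (cexp (p%:C * l)), l.
Qed.

Lemma is_cpow1 a : is_cpow a 1 a.
Proof.
rewrite /is_cpow oner_eq0; have [//|/cexp_surj[l <-]] := eqVneq a 0.
by exists l; rewrite ?mul1r.
Qed.

Lemma is_cpowM a b p u v : a != 0 -> b != 0 ->
  is_cpow a p u -> is_cpow b p v -> is_cpow (a * b) p (u * v).
Proof.
rewrite /is_cpow mulf_eq0 => /[dup] /negPf-> _ /[dup] /negPf-> _ /=.
move=> [l <- ->] [m <- ->]; exists (l + m); first exact: cexpD.
by rewrite mulrDr cexpD.
Qed.

(** If l and m are the logarithms behind u and v, then 2m - l is a logarithm of b, and it gives the
    missing factor t. For c = 0 also b = 0, and t = 0 works. *)
Lemma is_cpow_half_factor a b c p u v : p != 0 -> a != 0 -> a * b = c ^+ 2 ->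
  is_cpow a (p / 2) u -> is_cpow c p v ->
  exists2 t, is_cpow b (p / 2) t & u * t = v.
Proof.
move=> p0 a0 abc; have p20 : p / 2 != 0 by rewrite mulf_neq0 ?invr_eq0 ?pnatr_eq0.
rewrite /is_cpow (negPf a0) (negPf p0) (negPf p20).
have -> : (b == 0) = (c == 0).
  by rewrite -(sqrf_eq0 c) -abc mulf_eq0 (negPf a0).
have [_ _ ->|c0 [l la ->] [m mc ->]] := eqVneq c 0.
  by exists 0; rewrite ?mulr0.
exists (cexp ((p / 2)%:C * (m + m - l))).
  exists (m + m - l) => //; apply: (mulfI a0).
  by rewrite abc -la -cexpD addrC subrK cexpD mc.
rewrite -cexpD -mulrDr [l + _]addrC subrK; congr cexp.
by rewrite mulrDr -mulrDl -rmorphD -splitr.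
Qed.

Lemma sqr_is_cpow_half a v : is_cpow a (1 / 2) v -> v ^+ 2 = a.
Proof.
have half0 : 1 / 2 != 0 :> R by rewrite mulf_neq0 ?invr_eq0 ?pnatr_eq0 ?oner_eq0.
rewrite /is_cpow (negPf half0); have [-> ->|_ [l <- ->]] := eqVneq a 0.
  by rewrite expr0n.
by rewrite expr2 -cexpD -mulrDl -rmorphD -splitr mul1r.
Qed.

(** Shows that the pointwise formula is not vacuous. B and D are arbitrary values; C and E then
    absorb the constraints, through -2z (1 - x) = (z - 1)^2 and 2z (1 + x) = (z + 1)^2. *)
Lemma compatible_branches_exist s (w : R[i] -> R[i]) z A : 0 < s -> z != 0 ->
  is_cpow (z - 1) s (w z) -> is_cpow (-1) (s / 2) A ->
  exists B C D E, compatible_branches s w z A B C D E.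
Proof.
move=> s0 z0 wz cA; have z20 : 2 * z != 0 by rewrite mulf_neq0 ?pnatr_eq0.
have N10 : -1 != 0 :> R[i] by rewrite oppr_eq0 oner_eq0.
have [B cB] := is_cpow_exists (2 * z) (s / 2).
have [D cD] := is_cpow_exists (2 * z) (1 / 2).
have N2z0 : -1 * (2 * z) != 0 by rewrite mulf_neq0.
have subE : -1 * (2 * z) * (1 - (z + z^-1) / 2) = (z - 1) ^+ 2 by field.
have addE : 2 * z * (1 + (z + z^-1) / 2) = (z + 1) ^+ 2 by field.
have [C cC ABC] :=
  is_cpow_half_factor (lt0r_neq0 s0) N2z0 subE (is_cpowM N10 z20 cA cB) wz.
have [E cE DE] := is_cpow_half_factor (oner_neq0 R) z20 addE cD (is_cpow1 _).
by exists B, C, D, E.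
Qed.

End Branches.

(* (2z)^((s+n)/2) is read as (2z)^(s/2) ((2z)^(1/2))^n = B * D ^+ n. *)
Theorem theorem6 (R : realType) (s : R) (n : nat) (w : R[i] -> R[i])
    (P : {poly R[i]}) (hs : 1 <= s) (hn : (0 < n)%N)
    (hw : is_pow_branch s w) (hP : is_circle_chebyshev w n P) :
  [/\ forall z A : R[i], 0 < `|z| <= 1 -> is_cpow (-1) (s / 2) A ->
        exists B C D E, compatible_branches s w z A B C D E,
      ~~ odd n ->
        forall T : {poly R[i]}, is_jacobi_chebyshev (s / 2) 0 n./2 T ->
        (forall z x A B C D E : R[i], 0 < `|z| <= 1 -> x = (z + z^-1) / 2 ->
           compatible_branches s w z A B C D E ->
           w z * P.[z] = A * (B * D ^+ n) * C * T.[x]) /\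
        supnorm (unit_circle R) (fun z => w z * P.[z]) =
          2 `^ ((s + n%:R) / 2) * jacobi_norm (s / 2) 0 T &
      odd n ->
        forall T : {poly R[i]},
        is_jacobi_chebyshev (s / 2) (1 / 2) (n.-1)./2 T ->
        (forall z x A B C D E : R[i], 0 < `|z| <= 1 -> x = (z + z^-1) / 2 ->
           compatible_branches s w z A B C D E ->
           w z * P.[z] = A * (B * D ^+ n) * (C * E) * T.[x]) /\
        supnorm (unit_circle R) (fun z => w z * P.[z]) =
          2 `^ ((s + n%:R) / 2) * jacobi_norm (s / 2) (1 / 2) T].
Proof.
have s_gt0 : 0 < s by lra.
have [w_cpow _ _] := hw.
have normc_w z : normc z <= 1 -> normc (w z) = normc (z - 1) `^ s.
  by move=> z1; apply: normc_is_cpow; [apply: w_cpow; rewrite lecR|lra].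
split.
- move=> z A /andP[z_gt0 z_le1] cA; apply: compatible_branches_exist => //.
    by rewrite -normr_gt0.
  exact: w_cpow.
- move=> even_n T; have := circle_chebyshev_jacobi s_gt0 normc_w hP (T := T).
  rewrite (negPf even_n) mul0r => cheb /cheb[PE ->]; split=> //.
  move=> z x A B C D E /andP[z_gt0 _] -> [_ _ [cD _] <- _].
  (* Here 2z = D^2, so (2z)^(n/2) = D^n for even n. *)
  rewrite PE -?normr_gt0 // expr0 mul1r -(sqr_is_cpow_half cD) -exprM mul2n.
  by rewrite even_halfK //; ring.
- move=> odd_n T; have := circle_chebyshev_jacobi s_gt0 normc_w hP (T := T).
  have -> : (n.-1)./2 = n./2.
    by case: n odd_n {hn hP} => //= m /negPf; rewrite uphalf_half => ->.
  rewrite odd_n => cheb /cheb[PE ->]; split=> //.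
  move=> z x A B C D E /andP[z_gt0 _] -> [_ _ [cD _] <- DE].
  (* The factor z + 1 = D E supplies the last D, which completes (2z)^((n-1)/2) to D^n and leaves
     E. *)
  rewrite PE -?normr_gt0 // expr1 -DE -(sqr_is_cpow_half cD) -exprM mul2n.
  by rewrite -{2}(odd_double_half n) odd_n exprS; ring.
Qed.
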